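(* Let $\mathfrak U$ be the unfolding of a system $M$ under an unconditional independence relation $I$, and assume $\mathfrak U$ is finite. Then every execution of the procedure Explore described below, started by calling $\mathrm{Explore}(\{\bot\},\emptyset,\emptyset)$ with $U=\{\bot\}$, $G=\emptyset$, terminates (regardless of the nondeterministic choices), provided the set $\mathrm{Alt}(X,Y)$ is computed by a terminating procedure.
   Context: $\mathfrak U=(E,<,\#,h)$ is a labelled event structure (causality $<$ a strict partial order with finite down-sets, conflict $\#$ symmetric irreflexive and inherited along $<$) with a special minimal event $\bot$; a configuration is a finite causally closed conflict-free set of events; $[e]=\{e'\le e\}$, $\lceil e\rceil=\{e'<e\}$; $e,e'$ are in immediate conflict ($e\#_i e'$) if $e\#e'$ and both $\lceil e\rceil\cup[e']$ and $[e]\cup\lceil e'\rceil$ are configurations. For a configuration $C$: $\mathrm{ex}(C)=\{e\notin C:\lceil e\rceil\subseteq C\}$, $\mathrm{en}(C)=\{e\in\mathrm{ex}(C):C\cup\{e\}\text{ is a configuration}\}$, $\mathrm{cex}(C)=\{e\in\mathrm{ex}(C):\exists e'\in C,\ e\#_ie'\}$. For a set $U\subseteq E$, $\#_U(e)=\{e'\in U:e\#_ie'\}$. Given $U$, a configuration $C\subseteq U$ and $D\subseteq U$, an alternative to $D$ after $C$ is a configuration $J\subseteq U$ such that $C\cup J$ is a configuration and for every $e\in D$ there is $e'\in C\cup J$ with $e'\in\#_U(e)$; $\mathrm{Alt}(X,Y)$ is the set of all alternatives (w.r.t. the current global $U$) to $Y$ after $X$. Let $Q_{C,D,U}=C\cup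 D\cup\bigcup_{e\in C\cup D,\,e'\in\#_U(e)}[e']$. Algorithm: global sets $U$ (initially $\{\bot\}$) and $G$ (initially $\emptyset$); start with $\mathrm{Explore}(\{\bot\},\emptyset,\emptyset)$. $\mathrm{Explore}(C,D,A)$: (1) add $\mathrm{ex}(C)$ to $U$; (2) if $\mathrm{en}(C)\cap U=\emptyset$, return; (3) if $A=\emptyset$ choose any $e\in\mathrm{en}(C)\cap U$, else choose any $e\in A\cap\mathrm{en}(C)\cap U$; (4) call $\mathrm{Explore}(C\cup\{e\},D,A\setminus\{e\})$; (5) if some $J\in\mathrm{Alt}(C,D\cup\{e\})$ exists, call $\mathrm{Explore}(C,D\cup\{e\},J\setminus C)$; (6) Remove: move $\{e\}\setminus Q_{C,D,U}$ from $U$ to $G$, and for each $\hat e\in\#_U(e)$ move $[\hat e]\setminus Q_{C,D,U}$ from $U$ to $G$. *)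

(* Defs.v *)
(* MathComp world (classical sets of MathComp-Analysis). *)
From Stdlib Require Export Relation_Operators.
From mathcomp Require Export all_boot.
From mathcomp Require Export finmap.
From mathcomp Require Export boolp classical_sets functions cardinality.

Set Implicit Arguments.
Unset Strict Implicit.
Unset Printing Implicit Defensive.

Local Open Scope classical_set_scope.

(** * Systems and independence *)

(* A transition is a partial function on global states: [fire t s = None] means
   that [t] is not enabled at [s]. *)
Record system := System {
  state : Type;
  transition : Type;
  fire : transition -> state -> option state;
  init : state
}.

Section SystemTheory.
Variable M : system.
Implicit Types (s : state M) (t u : transition M) (r : seq (transition M)).

Fixpoint run s r : option (state M) :=
  if r is t :: r' then (if fire t s is Some s' then run s' r' else None)
  else Some s.

Definition reachable s := exists r, run (init M) r = Some s.

Definition enabled t s := exists s', fire t s = Some s'.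

Definition half_commute t u s :=
  forall s', fire t s = Some s' -> (enabled u s <-> enabled u s').

Definition commute_at t u s :=
  [/\ half_commute t u s, half_commute u t s &
      enabled t s -> enabled u s ->
      exists s', run s [:: t; u] = Some s' /\ run s [:: u; t] = Some s'].

End SystemTheory.

Record independence (M : system) := Independence {
  indep :> transition M -> transition M -> Prop;
  indep_sym : forall t u, indep t u -> indep u t;
  indep_irr : forall t, ~ indep t t;
  indep_commute : forall t u, indep t u ->
    forall s, reachable s -> commute_at t u s
}.

(** * Labelled event structures *)

Record les (A : Type) := Les {
  event : Type;
  lt : event -> event -> Prop;
  conflict : event -> event -> Prop;
  label : event -> A;
  bot : event;
  lt_irr : forall e, ~ lt e e;
  lt_trans : forall e1 e2 e3, lt e1 e2 -> lt e2 e3 -> lt e1 e3;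
  lt_finite : forall e, finite_set [set e' | lt e' e];
  conflict_sym : forall e e', conflict e e' -> conflict e' e;
  conflict_irr : forall e, ~ conflict e e;
  conflict_inherit : forall e e' e'',
    conflict e e' -> lt e' e'' -> conflict e e'';
  bot_minimal : forall e, ~ lt e bot
}.
Arguments lt {A l}.
Arguments conflict {A l}.
Arguments label {A l}.
Arguments bot {A}.

Section LesTheory.
Variables (A : Type) (L : les A).
Implicit Types (e : event L) (C U : set (event L)).

(* ⌈e⌉ and [e] *)
Definition causes e : set (event L) := [set e' | lt e' e].
Definition local e : set (event L) := causes e `|` [set e].

Definition configuration C :=
  [/\ finite_set C,
      forall e, C e -> causes e `<=` C &
      forall e e', C e -> C e' -> ~ conflict e e'].

Definition immediate_conflict e e' :=
  [/\ conflict e e', configuration (causes e `|` local e') &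
      configuration (local e `|` causes e')].

Definition ex C : set (event L) := [set e | ~ C e /\ causes e `<=` C].

Definition en C : set (event L) :=
  [set e | ex C e /\ configuration (C `|` [set e])].

(* #_U(e) *)
Definition confl_in U e : set (event L) :=
  [set e' | U e' /\ immediate_conflict e e'].

(* Alt(C, D) with respect to U *)
Definition Alt U C D : set (set (event L)) :=
  [set J | [/\ configuration J, J `<=` U, configuration (C `|` J) &
           forall e, D e -> exists e', (C `|` J) e' /\ confl_in U e e']].

Definition Q C D U : set (event L) :=
  C `|` D `|` \bigcup_(e in C `|` D) \bigcup_(e' in confl_in U e) local e'.

End LesTheory.

(** * The unfolding of a system under an independence relation *)

(* Events are the root [PBot] and the pairs <t, H> of a transition and a finite
   set of events, its history.  Finite sets cannot occur nested in an inductive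
   type, so the history is stored as a list; [pev] only builds lists that are the
   canonical enumeration of an [{fset _}], which makes <t, H> extensional in H. *)
Inductive preevent (T : Type) := PBot | PEv of T & seq (preevent T).
Arguments PBot {T}.

Section Unfolding.
Variables (M : system) (I : independence M).
Local Notation T := (transition M).
Local Notation pre := {classic preevent T}.
Implicit Types (t u : T) (e : pre) (H : {fset pre}).

Definition pbot : pre := PBot.
Definition pev t H : pre := PEv t (enum_fset H).

Definition phist e : seq pre := if e is PEv _ s then s else [::].

(* The root carries the empty label, rendered as [None]. *)
Definition plabel e : option T := if e is PEv t _ then Some t else None.

Definition plt e' e : Prop := e' \in phist e.
Definition ple e' e : Prop := plt e' e \/ e' = e.

Definition dependent (a b : option T) : Prop :=
  if a is Some t then (if b is Some u then ~ I t u else False) else False.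

(* Causally unrelated events with dependent labels are in conflict, and conflict
   is inherited by causal successors. *)
Definition pconflict e e' : Prop :=
  exists e1 e2, [/\ ple e1 e, ple e2 e', ~ ple e1 e2, ~ ple e2 e1 &
                    dependent (plabel e1) (plabel e2)].

Definition pconfiguration H : Prop :=
  (forall e e', e \in H -> plt e' e -> e' \in H) /\
  (forall e e', e \in H -> e' \in H -> ~ pconflict e e').

Definition interleaving H (s : seq pre) : Prop :=
  [/\ uniq s, s =i H &
      forall e e', e \in s -> e' \in s -> plt e e' -> index e s < index e' s].

(* [s] is the state reached by firing the labels of H in a causal order; all
   interleavings of a configuration of the unfolding reach the same state. *)
Definition state_of H (s : state M) : Prop :=
  exists2 l, interleaving H l & run (init M) (pmap plabel l) = Some s.

Definition pmaximal H e : Prop := e \in H /\ forall e', e' \in H -> ~ plt e e'.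

Definition is_history t H : Prop :=
  [/\ pbot \in H, pconfiguration H,
      exists2 s, state_of H s & enabled t s &
      H = [fset pbot]%fset \/
      forall e, pmaximal H e -> dependent (plabel e) (Some t)].

Inductive is_event : pre -> Prop :=
| is_event_bot : is_event pbot
| is_event_ev t H :
    (forall e, e \in H -> is_event e) -> is_history t H -> is_event (pev t H).

Definition uevent := {e : pre | is_event e}.
Definition ult (x y : uevent) := plt (sval x) (sval y).
Definition uconflict (x y : uevent) := pconflict (sval x) (sval y).
Definition ulabel (x : uevent) := plabel (sval x).
Definition ubot : uevent := exist _ pbot is_event_bot.

Lemma plt_trans e1 e2 e3 : is_event e3 -> plt e1 e2 -> plt e2 e3 -> plt e1 e3.
Proof.
case=> [|t H _ [_ [Hc _] _ _]] //= l12 l23; exact: Hc l23 l12.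
Qed.

Fixpoint pdepth (e : preevent T) : nat :=
  if e is PEv _ s then (foldr (fun x n => maxn (pdepth x) n) 0 s).+1 else 0.

Lemma plt_depth e e' : plt e e' -> pdepth e < pdepth e'.
Proof.
case: e' => // t s; rewrite /plt /= ltnS.
elim: s => // x s IHs; rewrite inE => /orP[/eqP->|/IHs le_es].
  exact: leq_maxl.
exact: leq_trans le_es (leq_maxr _ _).
Qed.

Lemma plt_irr e : ~ plt e e.
Proof. by move=> /plt_depth; rewrite ltnn. Qed.

Lemma dependent_sym a b : dependent a b -> dependent b a.
Proof. by case: a b => [t|] [u|] //= nI /indep_sym. Qed.

Lemma pconflict_sym e e' : pconflict e e' -> pconflict e' e.
Proof.
by move=> [e1 [e2 [? ? ? ? /dependent_sym]]]; exists e2, e1.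
Qed.

Lemma pconflict_irr e : is_event e -> ~ pconflict e e.
Proof.
case=> [|t H _ [_ [_ Hf] _ _]] [e1 [e2 [l1 l2 n12 n21 d]]].
  by case: l1 l2 n12 => [//|->] [//|->]; case; right.
case: l1 l2 => [l1|E1] [l2|E2].
- by apply: (Hf _ _ l1 l2); exists e1, e2; split=> //; right.
- by apply: n12; left; rewrite E2.
- by apply: n21; left; rewrite E1.
- by apply: n12; right; rewrite E1.
Qed.

Fact ult_irr x : ~ ult x x. Proof. exact: plt_irr. Qed.

Fact ult_trans x y z : ult x y -> ult y z -> ult x z.
Proof. exact: plt_trans (svalP z). Qed.

Fact ult_finite x : finite_set [set y | ult y x].
Proof.
apply: (@finite_preimage _ _ [set` phist (sval x)] sval); last exact: finite_seq.
by move=> [a pa] [b pb] _ _ /= E; apply: eq_exist.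
Qed.

Fact uconflict_sym x y : uconflict x y -> uconflict y x.
Proof. exact: pconflict_sym. Qed.

Fact uconflict_irr x : ~ uconflict x x.
Proof. exact: pconflict_irr (svalP x). Qed.

Fact uconflict_inherit x y z : uconflict x y -> ult y z -> uconflict x z.
Proof.
move=> [e1 [e2 [l1 l2 n12 n21 d]]] lyz; exists e1, e2; split=> //.
left; case: l2 => [l2|-> //]; exact: plt_trans (svalP z) l2 lyz.
Qed.

Fact ubot_minimal x : ~ ult x ubot. Proof. by []. Qed.

Definition unfolding : les (option T) :=
  Les ulabel ult_irr ult_trans ult_finite uconflict_sym uconflict_irr
      uconflict_inherit ubot_minimal.

End Unfolding.

(** * Nondeterministic programs and termination *)

Section Termination.
Variables (S : Type) (step : S -> S -> Prop) (returned : S -> Prop).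

(* Every execution from [c] is finite and can only end by returning. *)
Definition terminates (c : S) : Prop :=
  (forall f : nat -> S, f 0 = c -> ~ (forall n, step (f n) (f n.+1))) /\
  (forall c', clos_refl_trans S step c c' ->
     returned c' \/ exists c'', step c' c'').

End Termination.

(** * The procedure Explore *)

Section Explore.
Variables (A : Type) (L : les A).
Local Notation evset := (set (event L)).

(* A possibly nondeterministic program for Alt, called on U, X, Y. *)
Record alt_program := AltProgram {
  astate : Type;
  acall : evset -> evset -> evset -> astate;
  astep : astate -> astate -> Prop;
  aresult : astate -> option (set evset)
}.

Definition computes_Alt (P : alt_program) : Prop :=
  forall U C D : evset, configuration C -> C `<=` U -> D `<=` U ->
  terminates (@astep P) (fun p => exists R, aresult p = Some R) (acall P U C D) /\
  (forall p R, clos_refl_trans _ (@astep P) (acall P U C D) p ->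
     aresult p = Some R -> R = Alt U C D).

Variable P : alt_program.

(* Control points of a call: on entry; after step 1; after the first recursive
   call; while Alt is being computed; after step 5; inside the loop of step 6,
   with the events still to be treated. *)
Inductive point :=
| Enter
| Extended
| FirstDone of event L
| InAlt of event L & astate P
| SecondDone of event L
| Removing of evset.

Record frame := Frame { fC : evset; fD : evset; fA : evset; fpt : point }.

(* The call stack, active call first, and the global sets U and G. *)
Record config := Config { stack : seq frame; gU : evset; gG : evset }.

Inductive step : config -> config -> Prop :=
| step_extend C D X k U G :
    step (Config (Frame C D X Enter :: k) U G)
         (Config (Frame C D X Extended :: k) (U `|` ex C) G)
| step_return C D X k U G :
    en C `&` U = set0 ->
    step (Config (Frame C D X Extended :: k) U G) (Config k U G)
| step_first C D X k U G e :
    (en C `&` U) e -> (X <> set0 -> X e) ->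
    step (Config (Frame C D X Extended :: k) U G)
         (Config (Frame (C `|` [set e]) D (X `\ e) Enter ::
                  Frame C D X (FirstDone e) :: k) U G)
| step_alt_call C D X k U G e :
    step (Config (Frame C D X (FirstDone e) :: k) U G)
         (Config (Frame C D X (InAlt e (acall P U C (D `|` [set e]))) :: k) U G)
| step_alt_step C D X k U G e p p' :
    astep p p' ->
    step (Config (Frame C D X (InAlt e p) :: k) U G)
         (Config (Frame C D X (InAlt e p') :: k) U G)
| step_second C D X k U G e p R J :
    aresult p = Some R -> R J ->
    step (Config (Frame C D X (InAlt e p) :: k) U G)
         (Config (Frame C (D `|` [set e]) (J `\` C) Enter ::
                  Frame C D X (SecondDone e) :: k) U G)
| step_no_second C D X k U G e p :
    aresult p = Some set0 ->
    step (Config (Frame C D X (InAlt e p) :: k) U G)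
         (Config (Frame C D X (SecondDone e) :: k) U G)
| step_remove C D X k U G e :
    let V := [set e] `\` Q C D U in
    step (Config (Frame C D X (SecondDone e) :: k) U G)
         (Config (Frame C D X (Removing (confl_in U e)) :: k)
                 (U `\` V) (G `|` (U `&` V)))
| step_remove_next C D X k U G W e :
    W e ->
    let V := local e `\` Q C D U in
    step (Config (Frame C D X (Removing W) :: k) U G)
         (Config (Frame C D X (Removing (W `\ e)) :: k)
                 (U `\` V) (G `|` (U `&` V)))
| step_remove_end C D X k U G :
    step (Config (Frame C D X (Removing set0) :: k) U G) (Config k U G).

Definition start : config :=
  Config [:: Frame [set bot L] set0 set0 Enter] [set bot L] set0.

Definition explore_returned (c : config) : Prop := stack c = [::].

End Explore.
Arguments step {A L} P.
Arguments start {A L} P.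
Arguments explore_returned {A L P}.

(* Main.v *)
(* The argument works in any event structure with finitely many events.  When an
   event e is chosen, e is outside C by definition, and outside D because every
   event of D is in conflict with some event of the configuration C ∪ A, which
   contains e or, if A is empty, is extended by e.  Hence each recursive call
   enlarges C or D, so the call tree is finite.  Execution never gets stuck
   because a minimal event of A is enabled at C, and because Remove spares
   C ∪ D, so that Alt is always called on subsets of U. *)
Require Import Defs.
From Stdlib Require Import Operators_Properties.
From mathcomp Require Import zify.

Set Implicit Arguments.
Unset Strict Implicit.
Unset Printing Implicit Defensive.

Local Open Scope classical_set_scope.

(** The witness is cardinality, packaged so that later arguments see only strict monotonicity. *)
Lemma finite_strict_measure (T : Type) :
  finite_set [set: T] ->
  exists m : set T -> nat, forall (X Y : set T) x,
    X `<=` Y -> Y x -> ~ X x -> m X < m Y.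
Proof.
move=> finT; exists (fun X : set {classic T} => #|` fset_set X|%fset).
have fin (X : set {classic T}) : finite_set X by apply: sub_finite_set finT.
move=> X Y x XY Yx nXx; apply: fproper_ltn_card; apply/andP; split.
  by apply/fsubsetP => y; rewrite !in_fset_set // !inE; exact: XY.
apply/fsubsetPn; exists x; first by rewrite in_fset_set // inE.
by rewrite in_fset_set //; apply/negP; rewrite inE.
Qed.

Section NoInfiniteRun.
Variables (S : Type) (step : S -> S -> Prop).

Definition no_infinite_run (c : S) : Prop :=
  forall f : nat -> S, f 0 = c -> ~ (forall n, step (f n) (f n.+1)).

(** A run from [c'] extends backwards to one from [c], step by step. This carries termination of
    [Alt] from its call to any state reached later. *)
Lemma no_infinite_run_reachable c c' :
  no_infinite_run c -> clos_refl_trans S step c c' -> no_infinite_run c'.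
Proof.
move=> + cc'; elim: cc' => // [x y xy nx f f0 runf|x y z _ IHxy _ IHyz /IHxy/IHyz //].
apply: (nx (fun n => if n is n'.+1 then f n' else x)) => // -[|n] //=.
by rewrite f0.
Qed.

End NoInfiniteRun.

(** * Configurations of a finite event structure *)

Section ConfigurationTheory.
Variables (A : Type) (L : les A).
Hypothesis finL : finite_set [set: event L].
Implicit Types (e : event L) (C X U W : set (event L)).

Lemma configuration_bot : configuration [set bot L].
Proof.
split=> [|e -> e' /bot_minimal //|e e' -> ->]; last exact: conflict_irr.
exact: sub_finite_set finL.
Qed.

Lemma exists_minimal X : X !=set0 ->
  exists2 e, X e & forall e', lt e' e -> ~ X e'.
Proof.
have [m mlt] := finite_strict_measure finL.
(* Induction on the measure of the causes, which drops from [e] to any [e'] below it. *)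
move=> [e]; have [n] := ubnP (m (causes e)).
elim: n e => // n IHn e; rewrite ltnS => le_n Xe.
have [[e' [e'e Xe']]|none] := pselect (exists e', lt e' e /\ X e').
  apply: IHn Xe'; apply: leq_trans le_n; apply: (mlt _ _ e') => //.
  - by move=> e''; rewrite /causes /= => /lt_trans; exact.
  - exact: lt_irr.
by exists e => // e' e'e Xe'; apply: none; exists e'.
Qed.

Lemma en_of_union C X e :
  configuration C -> configuration (C `|` X) -> X e -> ~ C e ->
  causes e `<=` C -> en C e.
Proof.
move=> [_ clC _] [_ _ cfCX] Xe nCe eC; split=> //; split.
- exact: sub_finite_set finL.
- move=> e1 [/clC C1|->] e2 l2; left; [exact: C1|exact: eC].
- by move=> e1 e2 [C1|->] [C2|->]; apply: cfCX; by [left|right].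
Qed.

Lemma en_notin C e : en C e -> ~ C e.
Proof. by case=> -[]. Qed.

Lemma causes_sub C X e : configuration (C `|` X) -> X e ->
  (forall e', lt e' e -> ~ X e') -> causes e `<=` C.
Proof.
by move=> [_ cl _] Xe emin e' e'e; have [//|/(emin _ e'e)] := cl e (or_intror Xe) e' e'e.
Qed.

End ConfigurationTheory.

(** * The invariant of Explore *)

Section ExploreTerminates.
Variables (A : Type) (L : les A).
Hypothesis finL : finite_set [set: event L].
Variable P : alt_program L.
Hypothesis altP : computes_Alt P.
Local Notation frame := (frame P).
Local Notation config := (config P).
Implicit Types (e : event L) (C D X U W : set (event L)) (f g : frame).
Implicit Types (k : seq frame) (c : config).

(** [X] is what remains of an alternative to [D] after [C]. The last clause records plain conflict,
    so it does not depend on [U]. *)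
Definition ready C D X U : Prop :=
  [/\ configuration (C `|` X), forall e, X e -> ~ C e, X `<=` U &
      forall d, D d -> exists2 e, (C `|` X) e & conflict d e].

Definition active U f : Prop :=
  match fpt f with
  | Enter | Extended => ready (fC f) (fD f) (fA f) U
  | InAlt e p =>
      clos_refl_trans _ (@astep _ _ P) (acall P U (fC f) (fD f `|` [set e])) p
  | _ => True
  end.

Definition pending f : set (event L) :=
  match fpt f with FirstDone e | InAlt e _ => [set e] | _ => set0 end.

(* [C ∪ D] must stay in [U] while [f] is on the stack, the chosen event until
   [Alt] has returned. *)
Definition pinned f : set (event L) := fC f `|` fD f `|` pending f.

(** The second clause makes the second recursive call enlarge [D] strictly. *)
Definition frame_ok f : Prop :=
  configuration (fC f) /\ forall e, pending f e -> ~ fD f e.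

(** A suspended caller is stored at the point where it will resume. *)
Definition waiting f : Prop :=
  match fpt f with FirstDone _ | SecondDone _ => True | _ => False end.

(* [B] is the part [C ∪ D] of the frame above; its [Remove] keeps [B] in [U]. *)
Fixpoint chain (B : set (event L)) k : Prop :=
  if k is g :: k' then
    [/\ waiting g, pinned g `<=` B, frame_ok g & chain (fC g `|` fD g) k']
  else True.

Definition inv c : Prop :=
  if stack c is f :: k then
    [/\ active (gU c) f, pinned f `<=` gU c, frame_ok f & chain (fC f `|` fD f) k]
  else True.

Lemma inv_start : inv (start P).
Proof.
rewrite /inv /=; split=> //.
- by split=> //; rewrite setU0; exact: configuration_bot.
- by rewrite /pinned /pending /= !setU0.
- by split=> //=; exact: configuration_bot.
Qed.

(** At a [waiting] point [active] demands nothing, and the caller's pinned events lie in [C ∪ D] of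
    the returning frame. *)
Lemma chain_return U G f k :
  chain (fC f `|` fD f) k -> pinned f `<=` U -> inv (Config k U G).
Proof.
case: k => // g k [wg gf okg chg] fU; split=> //=.
  by move: wg; rewrite /waiting /active; case: (fpt g).
by move=> e /gf fe; apply: fU; left.
Qed.

Lemma pinned_remove C D U V W : C `|` D `<=` U -> C `|` D `<=` U `\` (V `\` Q C D W).
Proof. by move=> CDU e CDe; split; [exact: CDU|case=> _; apply; left]. Qed.

(** The first call inherits [ready] because moving [e] from [X] to [C] keeps [C ∪ X] fixed or, if
    [X] is empty, adds an enabled event. *)
Lemma chosen_event C D X U e : configuration C -> ready C D X U ->
  en C e -> (X <> set0 -> X e) -> [/\ ~ D e, configuration (C `|` [set e]) &
    ready (C `|` [set e]) D (X `\ e) U].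
Proof.
move=> cC [cCX XC XU DX] [[nCe eC] cCe] Xe; split=> //.
  move=> /DX [e' CXe'] ee'; have [X0|/eqP/Xe {}Xe] := eqVneq X set0.
    case: cCe => _ _ /(_ e e' (or_intror erefl)); apply=> //.
    by move: CXe'; rewrite X0 setU0; left.
  by case: cCX => _ _ /(_ e e' (or_intror Xe) CXe').
have split_e e' : (C `|` X) e' -> ((C `|` [set e]) `|` (X `\ e)) e'.
  have [->|ne] := pselect (e' = e); first by left; right.
  by case=> [Ce'|Xe']; [left; left|right].
split.
- have [X0|/eqP/Xe {}Xe] := eqVneq X set0; first by rewrite X0 set0D setU0.
  rewrite (_ : _ `|` _ = C `|` X) //; apply/seteqP; split=> // e'.
  by case=> [[|->]|[]]; by [left|right].
- by move=> e' [Xe' ne] [/(XC _ Xe')|].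
- by move=> e' [/XU].
- by move=> d /DX [e' /split_e]; exists e'.
Qed.

Lemma alt_context U C D X k G e p :
  inv (Config (Frame C D X (InAlt e p) :: k) U G) ->
  [/\ configuration C, C `<=` U & D `|` [set e] `<=` U].
Proof.
case=> _ /= pU [cC _] _; split=> // e'; first by move=> ?; apply: pU; left; left.
by case=> ?; apply: pU; [left; right|right].
Qed.

Lemma alt_result U C D X k G e p R :
  inv (Config (Frame C D X (InAlt e p) :: k) U G) -> aresult p = Some R ->
  R = Alt U C (D `|` [set e]).
Proof.
by move=> I; have [cC CU DU] := alt_context I; case: I => ? _ _ _;
  have [_] := altP cC CU DU; exact.
Qed.

Lemma inv_step c c' : inv c -> step P c c' -> inv c'.
Proof.
move=> I st; case: st I => {c c'}.
- move=> C D X k U G [[cCX XC XU DX] pU ok ch]; split=> //=.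
  + by split=> // e /XU; left.
  + by move=> e /pU; left.
- by move=> C D X k U G _ [_ pU _ ch]; exact: chain_return ch pU.
- move=> C D X k U G e [ene Ue] Xe [/= rdy pU [/= cC _] ch].
  have [nDe cCe rdy'] := chosen_event cC rdy ene Xe.
  split=> //=.
  + move=> e' [[[]|]|] // e'C; first by apply: pU; left; left.
      by rewrite e'C.
    by apply: pU; left; right.
  + split=> //; first by move=> e' [[]|->]; rewrite /=; tauto.
    by split=> // e' ->.
- move=> C D X k U G e [_ pU ok ch]; split=> //=; exact: rt_refl.
- move=> C D X k U G e p p' pp' [/= rp pU ok ch]; split=> //=.
  by apply: rt_trans rp _; exact: rt_step.
- move=> C D X k U G e p R J Rp RJ I; have RE := alt_result I Rp.
  have [cC CU DU] := alt_context I; case: I => _ pU ok ch.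
  move: RJ; rewrite RE => -[cJ JU cCJ Jconf].
  (* The second call receives only [J] without [C]; its union with [C] is still the configuration
     that [Alt] provides. *)
  have CJE : C `|` J `\` C = C `|` J by rewrite setUDr setDv setD0.
  split=> //=.
  + split=> //=.
    * by rewrite CJE.
    * by move=> ? [].
    * by move=> ? [/JU].
    * move=> d /Jconf [e' [CJe' [_ [cf _ _]]]]; exists e'; last exact: cf.
      by rewrite -CJE in CJe'.
  + by move=> e' [[/CU|/DU]|].
  + split=> //.
    by move=> e' [[?|?]|//]; [left|right; left].
- move=> C D X k U G e p _ [_ pU [cC _] ch]; split=> //.
  by move=> e' [CD|//]; apply: pU; left.
- move=> C D X k U G e V [_ pU [cC _] ch]; split=> //.
  by rewrite /pinned setU0; apply: pinned_remove => e' ?; apply: pU; left.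
- move=> C D X k U G W e We V [_ pU [cC _] ch]; split=> //.
  by rewrite /pinned setU0; apply: pinned_remove => e' ?; apply: pU; left.
- by move=> C D X k U G [_ pU _ ch]; exact: chain_return ch pU.
Qed.

(** * Absence of deadlock *)

Lemma progress c : inv c -> explore_returned c \/ exists c', step P c c'.
Proof.
case: c => -[|[C D X pt] k] U G I; [by left|right].
case: pt I => [|| e | e p | e | W] I.
- by eexists; exact: step_extend.
- case: I => -[cCX XC XU _] _ [cC _] _; rewrite /= in cCX XC XU cC.
  have [X0|/set0P /(exists_minimal finL) [e Xe emin]] := eqVneq X set0; last first.
    exists (Config (Frame (C `|` [set e]) D (X `\ e) (@Enter _ _ P) ::
                    Frame C D X (FirstDone P e) :: k) U G).
    apply: step_first => //; split; last exact: XU.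
    exact: en_of_union cCX Xe (XC _ Xe) (causes_sub cCX Xe emin).
  have [E|/set0P[e ene]] := eqVneq (en C `&` U) set0.
    by eexists; exact: step_return.
  by eexists; apply: (step_first _ _ _ ene); rewrite X0.
- by eexists; exact: step_alt_call.
- have [cC CU DU] := alt_context I.
  have [[_ fin] _] := altP cC CU DU.
  have rp : clos_refl_trans _ (@astep _ _ P) (acall P U C (D `|` [set e])) p by case: I.
  case: (fin p rp) => [[R Rp]|[p' pp']]; last by eexists; exact: step_alt_step pp'.
  have [R0|/set0P[J RJ]] := eqVneq R set0.
    by eexists; apply: step_no_second; rewrite Rp R0.
  by eexists; exact: step_second Rp RJ.
- by eexists; exact: step_remove.
- have [->|/set0P[e We]] := eqVneq W set0; eexists.
    exact: step_remove_end.
  exact: step_remove_next We.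
Qed.

(** * A weight that decreases outside [Alt] *)

Section Weight.
Variable m : set (event L) -> nat.
Hypothesis m_lt : forall X Y e, X `<=` Y -> Y e -> ~ X e -> m X < m Y.

Lemma measure_le X Y : X `<=` Y -> m X <= m Y.
Proof.
move=> XY; have [->//|/eqP neq] := eqVneq X Y.
have [YX|/existsNP[e /not_implyP[Ye nXe]]] := pselect (Y `<=` X).
  by case: neq; apply/seteqP.
by apply: ltnW; exact: m_lt Ye nXe.
Qed.

(** [call_weight n.+1] is the weight on entry of a call of slack [n]: two subcalls, [m setT] for the
    loop of Remove, and 6 for the control points. *)
Fixpoint call_weight n : nat :=
  if n is n'.+1 then 2 * call_weight n' + m setT + 6 else 0.

(** The first recursive call lowers one summand, the second call the other. *)
Definition slack C D : nat := m (~` C) + m (~` D).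

(* [call_weight (slack C D)] bounds the weight on entry of each of the two calls
   that may still be made from [C] and [D]. *)
Definition frame_weight f : nat :=
  let b := call_weight (slack (fC f) (fD f)) in
  match fpt f with
  | Enter => 2 * b + m setT + 6
  | Extended => 2 * b + m setT + 5
  | FirstDone _ => b + m setT + 4
  | InAlt _ _ => b + m setT + 3
  | SecondDone _ => m setT + 2
  | Removing W => m W + 1
  end.

Definition weight c : nat := sumn (map frame_weight (stack c)).

Lemma call_weight_lt n n' : n' < n ->
  2 * call_weight n' + m setT + 6 <= call_weight n.
Proof.
elim: n => // n IHn; rewrite ltnS leq_eqVlt => /orP[/eqP->//|/IHn /=]; lia.
Qed.

Lemma measure_setC_add C e : ~ C e -> m (~` (C `|` [set e])) < m (~` C).
Proof.
move=> nCe; apply: (m_lt (e := e)) => //; last by apply; right.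
by move=> e' nCee' Ce'; apply: nCee'; left.
Qed.

Definition alt_progress c c' : Prop := exists C D X k U G e p p',
  [/\ @astep _ _ P p p', c = Config (Frame C D X (InAlt e p) :: k) U G &
      c' = Config (Frame C D X (InAlt e p') :: k) U G].

Lemma step_weight c c' : inv c -> step P c c' ->
  weight c' < weight c \/ weight c' = weight c /\ alt_progress c c'.
Proof.
move=> I st; case: st I => {c c'}; rewrite /weight /=.
- by left; rewrite /frame_weight /=; lia.
- by left; rewrite /frame_weight /=; lia.
- move=> C D X k U G e [ene _] _ _; left.
  have := measure_setC_add (en_notin ene); rewrite -(ltn_add2r (m (~` D))).
  by move=> /call_weight_lt; rewrite /frame_weight /= /slack; lia.
- by left; rewrite /frame_weight /=; lia.
- move=> C D X k U G e p p' pp' _; right; split=> //.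
  by exists C, D, X, k, U, G, e, p, p'.
- move=> C D X k U G e p R J _ _ [_ _ [_ nDe] _]; left.
  have := measure_setC_add (nDe e erefl); rewrite -(ltn_add2l (m (~` C))).
  by move=> /call_weight_lt; rewrite /frame_weight /= /slack; lia.
- by left; rewrite /frame_weight /=; lia.
- move=> C D X k U G e _; left; rewrite /frame_weight /=.
  have := @measure_le (confl_in U e) setT (@subsetT _ _); lia.
- move=> C D X k U G W e We _; left; rewrite /frame_weight /=.
  suff : m (W `\ e) < m W by lia.
  by apply: (m_lt (e := e)) => // -[_]; apply.
- by left; rewrite /frame_weight /=; lia.
Qed.

(** The default [p0] is a filler: in the run considered below, every configuration is inside
    [Alt]. *)
Definition alt_state (p0 : astate P) c : astate P :=
  if stack c is Frame _ _ _ (InAlt _ p) :: _ then p else p0.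

Lemma inv_no_infinite_run c : inv c -> no_infinite_run (step P) c.
Proof.
have [n] := ubnP (weight c); elim: n c => // n IHn c; rewrite ltnS => le_n Ic.
move=> f f0 runf.
have If i : inv (f i).
  by elim: i => [|i IHi]; [rewrite f0|exact: inv_step IHi (runf i)].
have le_weight i : weight (f i) <= weight c.
  elim: i => [|i IHi]; first by rewrite f0.
  case: (step_weight (If i) (runf i)) => [lt_i|[-> //]].
  exact: leq_trans (ltnW lt_i) IHi.
(* If the weight ever drops, induction excludes the tail after the drop. Otherwise every step is
   internal to [Alt], which yields an infinite run of [P]. *)
have [[i lt_i]|no_lt] := pselect (exists i, weight (f i.+1) < weight (f i)).
  have lt_n := leq_trans lt_i (leq_trans (le_weight i) le_n).
  by apply: (IHn _ lt_n (If i.+1) (fun j => f (j + i.+1)) erefl) => j; exact: runf.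
have alt i : alt_progress (f i) (f i.+1).
  by case: (step_weight (If i) (runf i)) => [lt_i|[]//]; case: no_lt; exists i.
have [C [D [X [k [U [G [e [p [_ [_ cE _]]]]]]]]]] := alt 0.
have I0 := If 0; rewrite cE in I0.
have [cC CU DU] := alt_context I0.
have [[fin_call _] _] := altP cC CU DU.
have fin : no_infinite_run (@astep _ _ P) p.
  by apply: no_infinite_run_reachable fin_call _; case: I0.
apply: (fin (fun i => alt_state p (f i))); first by rewrite cE.
by move=> i; have [? [? [? [? [? [? [? [? [? [pp' -> ->]]]]]]]]]] := alt i.
Qed.

End Weight.

Lemma explore_terminates : terminates (step P) explore_returned (start P).
Proof.
split.
  have [m m_lt] := finite_strict_measure finL.
  exact: inv_no_infinite_run m_lt _ inv_start.
move=> c' /clos_rt_rtn1_iff reach; apply: progress.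
by elim: reach => [|c1 c2 st _ I1]; [exact: inv_start|exact: inv_step I1 st].
Qed.

End ExploreTerminates.

Theorem theorem2 (M : system) (I : independence M)
    (finU : finite_set [set: event (unfolding I)])
    (P : alt_program (unfolding I)) (altP : computes_Alt P) :
  terminates (step P) explore_returned (start P).
Proof. exact: explore_terminates. Qed.
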